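(* Let $t\in\mathbb{C}$ and let $\mathcal{B}=\mathcal{Y}(\mathfrak g,\theta(\mathfrak g))\subset\mathcal{Y}(\mathfrak{sl}(2))$ be the twisted Yangian of type I, i.e. the left coideal subalgebra generated by $H$ and $$\widetilde E^\pm=\widehat E^\pm\pm\alpha\,t\,E^\pm\pm\frac{\alpha}{4}(E^\pm H+HE^\pm).$$ Then $\mathcal{B}$ is a reflection algebra for the singlet boundary: the intertwining equation $$(T_{-u}\otimes\epsilon)[\Delta(b)]\,K(u)=K(u)\,(T_u\otimes\epsilon)[\Delta(b)]\qquad\text{for all }b\in\mathcal{B}$$ determines a nonzero $2\times2$ matrix $K(u)$ (with entries in $\mathbb{C}(u)$), uniquely up to an overall scalar factor, and this $K(u)$ satisfies the reflection equation $$R_{12}(u-v)\,K_1(u)\,R_{12}(u+v)\,K_2(v)=K_2(v)\,R_{12}(u+v)\,K_1(u)\,R_{12}(u-v)$$ on $\mathcal V\otimes\mathcal V$, $\mathcal V=\mathbb{C}^2$, $K_1=K\otimes1$, $K_2=1\otimes K$.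
   Context: $\mathcal{Y}(\mathfrak{sl}(2))$ is Drinfeld's Yangian (first realization) with formal deformation parameter $\alpha$, generated by $E^\pm,H$ and $\widehat E^\pm,\widehat H$ with $[H,E^\pm]=\pm2E^\pm$, $[E^+,E^-]=H$, $[H,\widehat E^\pm]=[\widehat H,E^\pm]=\pm2\widehat E^\pm$, $[E^\pm,\widehat E^\mp]=\pm\widehat H$, $[H,\widehat H]=0$, $[E^\pm,\widehat E^\pm]=0$, and Drinfeld's Serre-type relation for $\mathfrak{sl}(2)$. Coproduct: $\Delta(x)=x\otimes1+1\otimes x$ for $x\in\{E^\pm,H\}$, $\Delta(\widehat H)=\widehat H\otimes1+1\otimes\widehat H-\alpha(E^+\otimes E^--E^-\otimes E^+)$, $\Delta(\widehat E^\pm)=\widehat E^\pm\otimes1+1\otimes\widehat E^\pm\pm\frac{\alpha}{2}(E^\pm\otimes H-H\otimes E^\pm)$; the counit $\epsilon$ vanishes on all these generators. Fundamental evaluation representation on $\mathcal V=\mathbb{C}^2$: $T_u(E^+)=e_{1,2}$, $T_u(E^-)=e_{2,1}$, $T_u(H)=e_{1,1}-e_{2,2}$, $T_u(\widehat X)=u\,T_u(X)$ for $X=E^\pm,H$, and $T_u(\alpha)=1$. $R$-matrix in the basis $v_1\otimes v_1,v_1\otimes v_2,v_2\otimes v_1,v_2\otimes v_2$: $$R(u)=\begin{pmatrix}1&0&0&0\\0&r&1-r&0\\0&1-r&r&0\\0&0&0&1\end{pmatrix},\qquad r=\frac{u}{u-1}.$$ All identities are identities of rational functions in $u,v$. *)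

(* Defs.v *)
From HB Require Import structures.
From mathcomp Require Import all_boot all_order all_algebra.
From mathcomp Require Import boolp reals complex mxtens.

Set Implicit Arguments.
Unset Strict Implicit.
Unset Printing Implicit Defensive.

Import GRing.Theory Num.Theory.
Local Open Scope ring_scope.
Local Open Scope quotient_scope.

Inductive term (k G : Type) : Type :=
| Cst of k
| Gen of G
| Add of term k G & term k G
| Mul of term k G & term k G.
Arguments Cst {k G}.
Arguments Gen {k G}.

Declare Scope term_scope.
Delimit Scope term_scope with T.
Bind Scope term_scope with term.

Definition term_com (k : pzRingType) G (x y : term k G) : term k G :=
  Add (Mul x y) (Mul (Cst (- 1)) (Mul y x)).

Notation "x + y" := (Add x y) : term_scope.
Notation "x * y" := (Mul x y) : term_scope.
Notation "- x" := (Mul (Cst (- 1)) x) : term_scope.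
Notation "x - y" := (Add x (Mul (Cst (- 1)) y)) : term_scope.
Notation "⟦ x , y ⟧" := (term_com x y) (at level 0, x at level 99, y at level 99) : term_scope.

HB.instance Definition _ (k G : Type) := gen_eqMixin (term k G).
HB.instance Definition _ (k G : Type) := gen_choiceMixin (term k G).

(* The least congruence containing rel whose quotient is a unital associative
   algebra over k in which Cst c is the scalar c. *)
Inductive term_cong (k : comNzRingType) (G : Type)
    (rel : term k G -> term k G -> Prop) : term k G -> term k G -> Prop :=
| cong_rel x y : rel x y -> term_cong rel x y
| cong_refl x : term_cong rel x x
| cong_sym x y : term_cong rel x y -> term_cong rel y x
| cong_trans x y z : term_cong rel x y -> term_cong rel y z -> term_cong rel x z
| cong_add x x' y y' : term_cong rel x x' -> term_cong rel y y' ->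
    term_cong rel (x + y) (x' + y')
| cong_mul x x' y y' : term_cong rel x x' -> term_cong rel y y' ->
    term_cong rel (x * y) (x' * y')
| cong_addA x y z : term_cong rel (x + (y + z)) (x + y + z)
| cong_addC x y : term_cong rel (x + y) (y + x)
| cong_add0 x : term_cong rel (Cst 0 + x) x
| cong_addN x : term_cong rel (- x + x) (Cst 0)
| cong_mulA x y z : term_cong rel (x * (y * z)) (x * y * z)
| cong_mul1l x : term_cong rel (Cst 1 * x) x
| cong_mulDl x y z : term_cong rel ((x + y) * z) (x * z + y * z)
| cong_mulDr x y z : term_cong rel (x * (y + z)) (x * y + x * z)
| cong_cstD a b : term_cong rel (Cst (a + b)%R) (Cst a + Cst b)
| cong_cstM a b : term_cong rel (Cst (a * b)%R) (Cst a * Cst b)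
| cong_cstC a x : term_cong rel (Cst a * x) (x * Cst a).

Section PresentedAlgebra.
Variables (k : comNzRingType) (G : Type) (rel : term k G -> term k G -> Prop).

Definition term_eq (x y : term k G) : bool := `[< term_cong rel x y >].

Lemma term_eq_refl : reflexive term_eq.
Proof. by move=> x; apply/asboolP; apply: cong_refl. Qed.

Lemma term_eq_sym : symmetric term_eq.
Proof. by move=> x y; apply/asboolP/asboolP; apply: cong_sym. Qed.

Lemma term_eq_trans : transitive term_eq.
Proof.
by move=> y x z /asboolP xy /asboolP yz; apply/asboolP; apply: cong_trans xy yz.
Qed.

Canonical term_equiv := EquivRel term_eq term_eq_refl term_eq_sym term_eq_trans.

(* The k-algebra with generators G and relations x = y for rel x y. *)
Definition presented := {eq_quot term_eq}.

HB.instance Definition _ : EqQuotient _ term_eq presented :=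
  EqQuotient.on presented.
HB.instance Definition _ := Choice.on presented.

Definition pcls (x : term k G) : presented := \pi_presented x.

Lemma pclsP x y : term_cong rel x y <-> pcls x = pcls y.
Proof. by split=> [h|/eqquotP/asboolP //]; apply/eqquotP/asboolP. Qed.

Lemma pclsW (P : presented -> Prop) : (forall x, P (pcls x)) -> forall x, P x.
Proof. by move=> h x; rewrite -[x]reprK; apply: h. Qed.

Lemma repr_cong x : term_cong rel (repr (pcls x)) x.
Proof. by apply/pclsP; rewrite /pcls reprK. Qed.

Definition padd (x y : presented) := pcls (repr x + repr y)%T.
Definition pmul (x y : presented) := pcls (repr x * repr y)%T.
Definition pscale (c : k) (x : presented) := pcls (Cst c * repr x)%T.

Lemma padd_cls x y : padd (pcls x) (pcls y) = pcls (x + y)%T.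
Proof. by apply/pclsP/cong_add; apply: repr_cong. Qed.

Lemma pmul_cls x y : pmul (pcls x) (pcls y) = pcls (x * y)%T.
Proof. by apply/pclsP/cong_mul; apply: repr_cong. Qed.

Lemma pscale_cls c x : pscale c (pcls x) = pcls (Cst c * x)%T.
Proof. by apply/pclsP/cong_mul; [apply: cong_refl|apply: repr_cong]. Qed.

Let pE := (padd_cls, pmul_cls, pscale_cls).

Fact paddA : associative padd.
Proof.
by elim/pclsW=> x; elim/pclsW=> y; elim/pclsW=> z; rewrite !pE; apply/pclsP/cong_addA.
Qed.

Fact paddC : commutative padd.
Proof. by elim/pclsW=> x; elim/pclsW=> y; rewrite !pE; apply/pclsP/cong_addC. Qed.

Fact padd0 : left_id (pcls (Cst 0)) padd.
Proof. by elim/pclsW=> x; rewrite !pE; apply/pclsP/cong_add0. Qed.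

Fact paddN : left_inverse (pcls (Cst 0)) (pscale (- 1)) padd.
Proof. by elim/pclsW=> x; rewrite !pE; apply/pclsP/cong_addN. Qed.

Fact pmulA : associative pmul.
Proof.
by elim/pclsW=> x; elim/pclsW=> y; elim/pclsW=> z; rewrite !pE; apply/pclsP/cong_mulA.
Qed.

Fact pmul1l : left_id (pcls (Cst 1)) pmul.
Proof. by elim/pclsW=> x; rewrite !pE; apply/pclsP/cong_mul1l. Qed.

Fact pmul1r : right_id (pcls (Cst 1)) pmul.
Proof.
elim/pclsW=> x; rewrite !pE; apply/pclsP.
exact: cong_trans (cong_sym (cong_cstC _ _ _)) (cong_mul1l _ _).
Qed.

Fact pmulDl : left_distributive pmul padd.
Proof.
by elim/pclsW=> x; elim/pclsW=> y; elim/pclsW=> z; rewrite !pE; apply/pclsP/cong_mulDl.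
Qed.

Fact pmulDr : right_distributive pmul padd.
Proof.
by elim/pclsW=> x; elim/pclsW=> y; elim/pclsW=> z; rewrite !pE; apply/pclsP/cong_mulDr.
Qed.

HB.instance Definition _ := GRing.isPzRing.Build presented
  paddA paddC padd0 paddN pmulA pmul1l pmul1r pmulDl pmulDr.

Fact pscaleA a b v : pscale a (pscale b v) = pscale (a * b) v.
Proof.
elim/pclsW: v => x; rewrite !pE; apply/pclsP.
apply: cong_trans (cong_mulA _ _ _ _) _.
by apply: cong_mul; [apply/cong_sym/cong_cstM|apply: cong_refl].
Qed.

Fact pscale1 : left_id 1 pscale.
Proof. by elim/pclsW=> x; rewrite !pE; apply/pclsP/cong_mul1l. Qed.

Fact pscaleDr : right_distributive pscale +%R.
Proof.
move=> c; elim/pclsW=> x; elim/pclsW=> y.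
by rewrite /GRing.add /= !pE; apply/pclsP/cong_mulDr.
Qed.

Fact pscaleDl v : {morph pscale^~ v : a b / a + b}.
Proof.
elim/pclsW: v => x a b; rewrite /GRing.add /= !pE; apply/pclsP.
apply: cong_trans (cong_mulDl _ _ _ _).
by apply: cong_mul; [apply/cong_cstD|apply: cong_refl].
Qed.

HB.instance Definition _ := GRing.Zmodule_isLmodule.Build k presented
  pscaleA pscale1 pscaleDr pscaleDl.

Lemma presented_scaleAl (c : k) (x y : presented) : c *: (x * y) = c *: x * y.
Proof.
elim/pclsW: x => x; elim/pclsW: y => y.
by rewrite /GRing.scale /GRing.mul /= !pE; apply/pclsP/cong_mulA.
Qed.

Lemma presented_scaleAr (c : k) (x y : presented) : c *: (x * y) = x * (c *: y).
Proof.
elim/pclsW: x => x; elim/pclsW: y => y.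
rewrite /GRing.scale /GRing.mul /= !pE; apply/pclsP.
apply: cong_trans (cong_mulA _ _ _ _) (cong_trans _ (cong_sym (cong_mulA _ _ _ _))).
by apply: cong_mul; [apply: cong_cstC|apply: cong_refl].
Qed.

Lemma pclsD x y : pcls (x + y)%T = pcls x + pcls y.
Proof. by rewrite -padd_cls. Qed.

Lemma pclsM x y : pcls (x * y)%T = pcls x * pcls y.
Proof. by rewrite -pmul_cls. Qed.

Lemma pcls_cst c : pcls (Cst c) = c *: (1 : presented).
Proof.
rewrite /GRing.scale /GRing.one /= pscale_cls; apply/pclsP.
exact: cong_trans (cong_sym (cong_mul1l _ _)) (cong_sym (cong_cstC _ _ _)).
Qed.

Lemma pcls_rel x y : rel x y -> pcls x = pcls y.
Proof. by move=> h; apply/pclsP/cong_rel. Qed.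

End PresentedAlgebra.

Fixpoint term_eval (k G : Type) (S : pzRingType) (f : k -> S) (g : G -> S)
    (x : term k G) : S :=
  match x with
  | Cst c => f c
  | Gen i => g i
  | Add x y => term_eval f g x + term_eval f g y
  | Mul x y => term_eval f g x * term_eval f g y
  end.

(* The ring morphism out of a presented algebra that extends f on scalars and g
   on generators; it is well defined when presented_model below holds. *)
Definition presented_map (k : comNzRingType) G rel (S : pzRingType)
    (f : k -> S) (g : G -> S) (x : @presented k G rel) : S :=
  term_eval f g (repr x).

Section PresentedMap.
Variables (k : comNzRingType) (G : Type) (rel : term k G -> term k G -> Prop).
Variables (S : pzRingType) (f : {rmorphism k -> S}) (g : G -> S).

Definition presented_model : Prop :=
  (forall c x, f c * x = x * f c) /\
  (forall x y, rel x y -> term_eval f g x = term_eval f g y).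

Hypothesis model : presented_model.

Lemma term_eval_cong x y :
  term_cong rel x y -> term_eval f g x = term_eval f g y.
Proof.
case: model => fC frel; elim=> {x y} //=.
- by move=> x y z _ -> _ ->.
- by move=> x x' y y' _ -> _ ->.
- by move=> x x' y y' _ -> _ ->.
- by move=> x y z; rewrite addrA.
- by move=> x y; rewrite addrC.
- by move=> x; rewrite rmorph0 add0r.
- by move=> x; rewrite rmorph0 rmorphN rmorph1 mulN1r addNr.
- by move=> x y z; rewrite mulrA.
- by move=> x; rewrite rmorph1 mul1r.
- by move=> x y z; rewrite mulrDl.
- by move=> x y z; rewrite mulrDr.
- by move=> a b; rewrite rmorphD.
- by move=> a b; rewrite rmorphM.
Qed.

Local Notation phi := (@presented_map k G rel S f g).

Lemma presented_map_cls x : phi (pcls rel x) = term_eval f g x.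
Proof. exact/term_eval_cong/repr_cong. Qed.

Lemma presented_map_zmod : zmod_morphism phi.
Proof.
elim/pclsW=> x; elim/pclsW=> y.
have -> : pcls rel x - pcls rel y = pcls rel (x - y)%T.
  by rewrite pclsD pclsM pcls_cst -presented_scaleAl mul1r scaleN1r.
by rewrite !presented_map_cls /= rmorphN rmorph1 mulN1r.
Qed.

Lemma presented_map_monoid : monoid_morphism phi.
Proof.
split=> [|x y].
  by rewrite -[X in phi X]scale1r -pcls_cst presented_map_cls /= rmorph1.
elim/pclsW: x => x; elim/pclsW: y => y.
by rewrite -pclsM !presented_map_cls.
Qed.

Lemma presented_mapZ c x : phi (c *: x) = f c * phi x.
Proof.
have -> : c *: x = c *: (1 : presented rel) * x by rewrite -presented_scaleAl mul1r.
by case: presented_map_monoid => _ ->; rewrite -pcls_cst presented_map_cls.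
Qed.

End PresentedMap.

Inductive tens_rel (k : comNzRingType) (A B : algType k) :
    term k (A + B) -> term k (A + B) -> Prop :=
| tens_scal_l c : tens_rel (Gen (inl (c%:A))) (Cst c)
| tens_add_l a b : tens_rel (Gen (inl (a + b)%R)) (Gen (inl a) + Gen (inl b))
| tens_mul_l a b : tens_rel (Gen (inl (a * b)%R)) (Gen (inl a) * Gen (inl b))
| tens_scal_r c : tens_rel (Gen (inr (c%:A))) (Cst c)
| tens_add_r a b : tens_rel (Gen (inr (a + b)%R)) (Gen (inr a) + Gen (inr b))
| tens_mul_r a b : tens_rel (Gen (inr (a * b)%R)) (Gen (inr a) * Gen (inr b))
| tens_comm a b : tens_rel (Gen (inl a) * Gen (inr b)) (Gen (inr b) * Gen (inl a)).

(* The tensor product of two algebras over k, given by its universal property: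
   it is generated by a commuting pair of copies of A and B. *)
Definition tens (k : comNzRingType) (A B : algType k) := presented (@tens_rel k A B).

HB.instance Definition _ k A B := GRing.PzRing.on (@tens k A B).
HB.instance Definition _ k A B := GRing.Lmodule.on (@tens k A B).

Definition tpure (k : comNzRingType) (A B : algType k) (a : A) (b : B) : tens A B :=
  pcls _ (Gen (inl a)) * pcls _ (Gen (inr b)).

Notation "a ⊗ b" := (tpure a b) (at level 40, left associativity) : ring_scope.

(* a ⊗ b is sent to g a * h b. *)
Definition tens_map (k : comNzRingType) (A B : algType k) (S : pzRingType)
    (f : k -> S) (g : A -> S) (h : B -> S) : tens A B -> S :=
  presented_map f (fun x => match x with inl a => g a | inr b => h b end).

Section TensorTheory.
Variables (k : comNzRingType) (A B : algType k).

Lemma tens_inl1 : pcls (@tens_rel k A B) (Gen (inl 1)) = 1.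
Proof.
by have := pcls_rel (@tens_scal_l k A B 1); rewrite pcls_cst !scale1r.
Qed.

Lemma tens_inr1 : pcls (@tens_rel k A B) (Gen (inr 1)) = 1.
Proof.
by have := pcls_rel (@tens_scal_r k A B 1); rewrite pcls_cst !scale1r.
Qed.

Lemma tens_inlE (a : A) : pcls (@tens_rel k A B) (Gen (inl a)) = a ⊗ 1.
Proof. by rewrite /tpure tens_inr1 mulr1. Qed.

Lemma tens_inrE (b : B) : pcls (@tens_rel k A B) (Gen (inr b)) = 1 ⊗ b.
Proof. by rewrite /tpure tens_inl1 mul1r. Qed.

Lemma tpure11 : (1 : A) ⊗ (1 : B) = 1.
Proof. by rewrite /tpure tens_inl1 tens_inr1 mul1r. Qed.

Lemma tpureM (a a' : A) (b b' : B) : (a ⊗ b) * (a' ⊗ b') = (a * a') ⊗ (b * b').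
Proof.
rewrite /tpure (pcls_rel (tens_mul_l _ _ _)) (pcls_rel (tens_mul_r _ _ _)) !pclsM.
rewrite -!mulrA; congr (_ * _); rewrite !mulrA; congr (_ * _).
by rewrite -!pclsM (pcls_rel (tens_comm _ _)).
Qed.

Lemma tpureDl (a a' : A) (b : B) : (a + a') ⊗ b = a ⊗ b + a' ⊗ b.
Proof. by rewrite /tpure (pcls_rel (tens_add_l _ _ _)) pclsD mulrDl. Qed.

Lemma tpureDr (a : A) (b b' : B) : a ⊗ (b + b') = a ⊗ b + a ⊗ b'.
Proof. by rewrite /tpure (pcls_rel (tens_add_r _ _ _)) pclsD mulrDr. Qed.

Lemma tpureZl c (a : A) (b : B) : (c *: a) ⊗ b = c *: (a ⊗ b).
Proof.
rewrite -[a in LHS]mul1r scalerAl /tpure (pcls_rel (tens_mul_l _ _ _)) pclsM.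
by rewrite (pcls_rel (tens_scal_l _ _ _)) pcls_cst -!presented_scaleAl mul1r.
Qed.

Lemma tpureZr c (a : A) (b : B) : a ⊗ (c *: b) = c *: (a ⊗ b).
Proof.
rewrite -[b in LHS]mul1r scalerAl /tpure (pcls_rel (tens_mul_r _ _ _)) pclsM.
rewrite (pcls_rel (tens_scal_r _ _ _)) pcls_cst -!presented_scaleAl mul1r.
by rewrite presented_scaleAr.
Qed.

Section Map.
Variables (S : pzRingType) (f : {rmorphism k -> S}).
Variables (g : {rmorphism A -> S}) (h : {rmorphism B -> S}).
Hypothesis fC : forall c x, f c * x = x * f c.
Hypothesis gf : forall c, g (c%:A) = f c.
Hypothesis hf : forall c, h (c%:A) = f c.
Hypothesis ghC : forall a b, g a * h b = h b * g a.

Lemma tens_model : presented_model (@tens_rel k A B) f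
  (fun x => match x with inl a => g a | inr b => h b end).
Proof.
split=> // x y; case=> //= *; by rewrite ?rmorphD ?rmorphM.
Qed.

Lemma tens_mapE (a : A) (b : B) : tens_map f g h (a ⊗ b) = g a * h b.
Proof.
have [_ hM] := presented_map_monoid tens_model.
by rewrite /tens_map /tpure hM !(presented_map_cls tens_model).
Qed.
End Map.

End TensorTheory.

Inductive subalg_gen (k : pzRingType) (A : lalgType k) (X : A -> Prop) : A -> Prop :=
| subalg_base x : X x -> subalg_gen X x
| subalg_scal c : subalg_gen X (c%:A)
| subalg_add x y : subalg_gen X x -> subalg_gen X y -> subalg_gen X (x + y)
| subalg_mul x y : subalg_gen X x -> subalg_gen X y -> subalg_gen X (x * y).

(* Normal forms of noncommutative integer polynomials: a monomial is a word in
   numbered letters, and rule y x rewrites the two-letter word y x. *)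
Definition npoly := seq (int * seq nat).

Inductive nexp := NV of nat | NN of nexp | NA of nexp & nexp | NM of nexp & nexp.

Definition nscale (c : int) (p : npoly) : npoly := [seq (c * m.1, m.2) | m <- p].
Definition nmul (p q : npoly) : npoly :=
  flatten [seq [seq (m.1 * n.1, m.2 ++ n.2) | n <- q] | m <- p].

Fixpoint npoly_of (x : nexp) : npoly :=
  match x with
  | NV i => [:: (1, [:: i])]
  | NN x => nscale (-1) (npoly_of x)
  | NA x y => npoly_of x ++ npoly_of y
  | NM x y => nmul (npoly_of x) (npoly_of y)
  end.

Fixpoint nadd1 (m : int * seq nat) (p : npoly) : npoly :=
  if p is n :: p' then
    if m.2 == n.2 then (if m.1 + n.1 == 0 then p' else (m.1 + n.1, n.2) :: p')
    else n :: nadd1 m p'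
  else if m.1 == 0 then [::] else [:: m].

Definition ncollect (p : npoly) : npoly := foldr nadd1 [::] p.

Section Rewriting.
Variable rule : nat -> nat -> option npoly.

Fixpoint nred (w : seq nat) : option npoly :=
  if w is y :: w' then
    if w' is x :: w'' then
      if rule y x is Some r then Some [seq (m.1, m.2 ++ w'') | m <- r]
      else omap (fun p => [seq (m.1, y :: m.2) | m <- p]) (nred w')
    else None
  else None.

Definition nstep (p : npoly) : npoly :=
  ncollect (flatten [seq if nred m.2 is Some r then nscale m.1 r else [:: m] | m <- p]).

Definition nnorm n (p : npoly) : npoly := iter n nstep (ncollect p).

Variables (A : pzRingType) (e : nat -> A).

Fixpoint nden (x : nexp) : A :=
  match x with
  | NV i => e i
  | NN x => - nden x
  | NA x y => nden x + nden y
  | NM x y => nden x * nden y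
  end.

Definition wden (w : seq nat) : A := \prod_(i <- w) e i.
Definition pden (p : npoly) : A := \sum_(m <- p) wden m.2 *~ m.1.

Lemma wden_cat v w : wden (v ++ w) = wden v * wden w.
Proof. by rewrite /wden big_cat. Qed.

Lemma pden_cat p q : pden (p ++ q) = pden p + pden q.
Proof. by rewrite /pden big_cat. Qed.

Lemma pden_scale c p : pden (nscale c p) = pden p *~ c.
Proof.
rewrite /pden big_map mulrz_suml; apply: eq_bigr => m _ /=.
by rewrite mulrC mulrzA.
Qed.

Lemma pden_mul p q : pden (nmul p q) = pden p * pden q.
Proof.
elim: p => [|m p ih]; first by rewrite /nmul /pden !big_nil mul0r.
rewrite /nmul /= pden_cat -/(nmul p q) ih [pden (m :: p)]/pden big_cons mulrDl.
congr (_ + _).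
rewrite /pden big_map mulr_sumr; apply: eq_bigr => n _ /=.
by rewrite wden_cat mulrzAl mulrzAr -mulrzA mulrC.
Qed.

Lemma npoly_ofP x : pden (npoly_of x) = nden x.
Proof.
elim: x => /= [i|x ih|x ihx y ihy|x ihx y ihy].
- by rewrite /pden /wden !big_seq1.
- by rewrite pden_scale ih mulrNz mulr1z.
- by rewrite pden_cat ihx ihy.
- by rewrite pden_mul ihx ihy.
Qed.

Lemma nadd1P m p : pden (nadd1 m p) = wden m.2 *~ m.1 + pden p.
Proof.
elim: p => [|n p ih] /=.
  by case: eqP => [->|_]; rewrite /pden ?big_seq1 ?big_nil ?mulr0z addr0.
case: eqP => [mn|_]; last first.
  by rewrite [in LHS]/pden big_cons -/(pden _) ih [in RHS]/pden big_cons addrCA.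
rewrite mn [in RHS]/pden big_cons addrA -mulrzDr -/(pden p).
by case: eqP => [->|_]; rewrite ?mulr0z ?add0r // /pden big_cons.
Qed.

Lemma ncollectP p : pden (ncollect p) = pden p.
Proof. by elim: p => //= m p ih; rewrite nadd1P ih [in RHS]/pden big_cons. Qed.

Hypothesis ruleP : forall y x r, rule y x = Some r -> e y * e x = pden r.

Lemma nredP w p : nred w = Some p -> wden w = pden p.
Proof.
elim: w p => [|y [|x w] ih] p //.
have -> : nred (y :: x :: w) =
  if rule y x is Some r then Some [seq (m.1, m.2 ++ w) | m <- r]
  else omap (fun p => [seq (m.1, y :: m.2) | m <- p]) (nred (x :: w)) by [].
case E: (rule y x) => [r|].
  case=> <-; rewrite /wden !big_cons mulrA (ruleP E) /pden big_map mulr_suml.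
  by apply: eq_bigr => m _ /=; rewrite -/(wden _) wden_cat mulrzAl.
move: ih; case: (nred (x :: w)) => [q|] //= /(_ q erefl) h [<-].
rewrite {1}/wden big_cons -/(wden _) h /pden big_map mulr_sumr.
by apply: eq_bigr => m _ /=; rewrite /wden big_cons mulrzAr.
Qed.

Lemma nstepP p : pden (nstep p) = pden p.
Proof.
rewrite /nstep ncollectP; elim: p => //= m p ih.
rewrite pden_cat ih [in RHS]/pden big_cons; congr (_ + _).
case E: (nred m.2) => [r|]; first by rewrite pden_scale (nredP E).
by rewrite /pden big_seq1.
Qed.

Lemma nnormP n x y : nnorm n (npoly_of (NA x (NN y))) = [::] -> nden x = nden y.
Proof.
move=> h; apply/eqP; rewrite -subr_eq0 -[_ - _]/(nden (NA x (NN y))) -npoly_ofP.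
have <- : pden (nnorm n (npoly_of (NA x (NN y)))) = pden (npoly_of (NA x (NN y))).
  rewrite /nnorm -[RHS]ncollectP; elim: n {h} => //= n <-; exact: nstepP.
by rewrite h /pden big_nil.
Qed.
End Rewriting.

(* h marks a generator with a hat, p and m the superscripts + and -. *)
Inductive ygen := gEp | gEm | gH | gEph | gEmh | gHh.

Section Yangian.
Variable C : numFieldType.
Local Notation k := {poly C}.

(* The formal parameter of the Yangian, which is an algebra over C[alpha]. *)
Definition alpha : k := 'X.

Local Notation E := (Gen gEp).
Local Notation F := (Gen gEm).
Local Notation H := (Gen gH).
Local Notation Eh := (Gen gEph).
Local Notation Fh := (Gen gEmh).
Local Notation Hh := (Gen gHh).

(* For sl(2), Drinfeld's Serre-type relations reduce to yrel_serre; its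
   coefficient alpha^2 is the one for which coprod below respects it
   (coprod_model). *)
Inductive yangian_rel : term k ygen -> term k ygen -> Prop :=
| yrel_HE : yangian_rel ⟦H, E⟧ (Cst 2 * E)
| yrel_HF : yangian_rel ⟦H, F⟧ (- (Cst 2 * F))
| yrel_EF : yangian_rel ⟦E, F⟧ H
| yrel_HEh : yangian_rel ⟦H, Eh⟧ (Cst 2 * Eh)
| yrel_HFh : yangian_rel ⟦H, Fh⟧ (- (Cst 2 * Fh))
| yrel_HhE : yangian_rel ⟦Hh, E⟧ (Cst 2 * Eh)
| yrel_HhF : yangian_rel ⟦Hh, F⟧ (- (Cst 2 * Fh))
| yrel_EFh : yangian_rel ⟦E, Fh⟧ Hh
| yrel_FEh : yangian_rel ⟦F, Eh⟧ (- Hh)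
| yrel_HHh : yangian_rel ⟦H, Hh⟧ (Cst 0)
| yrel_EEh : yangian_rel ⟦E, Eh⟧ (Cst 0)
| yrel_FFh : yangian_rel ⟦F, Fh⟧ (Cst 0)
| yrel_serre :
    yangian_rel ⟦Hh, ⟦Eh, Fh⟧⟧ (Cst (alpha ^+ 2) * ((Fh * E - F * Eh) * H)).

Definition yangian := presented yangian_rel.

HB.instance Definition _ := GRing.PzRing.on yangian.
HB.instance Definition _ := GRing.Lmodule.on yangian.

Definition yg (g : ygen) : yangian := pcls _ (Gen g).

Definition counit : yangian -> k := presented_map idfun (fun=> 0).

Fact counit_model : presented_model yangian_rel (idfun : k -> k) (fun=> 0).
Proof.
split=> [c x|x y]; first exact: mulrC.
by case=> /=; rewrite !(mulr0, mul0r, addr0).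
Qed.

HB.instance Definition _ :=
  GRing.isZmodMorphism.Build yangian k counit (presented_map_zmod counit_model).
HB.instance Definition _ :=
  GRing.isMonoidMorphism.Build yangian k counit
    (presented_map_monoid counit_model).

Fact yangian_nonzero1 : (1 : yangian) != 0.
Proof.
apply/eqP=> /(congr1 counit); rewrite rmorph1 rmorph0.
by move/eqP; rewrite oner_eq0.
Qed.

HB.instance Definition _ :=
  GRing.PzSemiRing_isNonZero.Build yangian yangian_nonzero1.
HB.instance Definition _ :=
  GRing.Lmodule_isLalgebra.Build k yangian (@presented_scaleAl _ _ yangian_rel).
HB.instance Definition _ :=
  GRing.Lalgebra_isAlgebra.Build k yangian (@presented_scaleAr _ _ yangian_rel).

Lemma counit_gen g : counit (yg g) = 0.
Proof. exact: (presented_map_cls counit_model). Qed.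

Lemma counit_scalar c : counit (c%:A) = c.
Proof. by rewrite /counit (presented_mapZ counit_model) -/counit rmorph1 mulr1. Qed.

Definition yangian2 := tens yangian yangian.

HB.instance Definition _ := GRing.PzRing.on yangian2.
HB.instance Definition _ := GRing.Lmodule.on yangian2.

Fact yangian2_nonzero1 : (1 : yangian2) != 0.
Proof.
pose g : {rmorphism yangian -> k} := counit.
pose G (x : yangian + yangian) := match x with inl a => g a | inr b => g b end.
have m : presented_model (@tens_rel k yangian yangian) (idfun : k -> k) G.
  apply: tens_model => //=; [exact: mulrC | exact: counit_scalar
    | exact: counit_scalar | by move=> *; exact: mulrC].
have [h1 _] := presented_map_monoid m; have h0 := presented_map_zmod m.
apply/eqP=> /(congr1 (presented_map idfun G)).
rewrite h1 -[0 in RHS](subrr (1 : yangian2)) h0 subrr.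
by move/eqP; rewrite oner_eq0.
Qed.

HB.instance Definition _ :=
  GRing.PzSemiRing_isNonZero.Build yangian2 yangian2_nonzero1.
HB.instance Definition _ := GRing.Lmodule_isLalgebra.Build k yangian2
  (@presented_scaleAl _ _ (@tens_rel k yangian yangian)).
HB.instance Definition _ := GRing.Lalgebra_isAlgebra.Build k yangian2
  (@presented_scaleAr _ _ (@tens_rel k yangian yangian)).

Definition coprod_gen (g : ygen) : yangian2 :=
  let E := yg gEp in let F := yg gEm in let H := yg gH in
  let D x : yangian2 := x ⊗ 1 + 1 ⊗ x in
  match g with
  | gEp => D E
  | gEm => D F
  | gH => D H
  | gEph => D (yg gEph) + (2^-1 *: alpha) *: (E ⊗ H - H ⊗ E)
  | gEmh => D (yg gEmh) - (2^-1 *: alpha) *: (F ⊗ H - H ⊗ F)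
  | gHh => D (yg gHh) - alpha *: (E ⊗ F - F ⊗ E)
  end.

Definition coprod : yangian -> yangian2 :=
  presented_map (in_alg yangian2) coprod_gen.

End Yangian.

Definition ylet_rule (o y x : nat) : option npoly :=
  omap (fun p : npoly => [seq (m.1, map (addn o) m.2) | m <- p])
  match y, x with
  | 2, 1 => Some [:: (1, [:: 1; 2]%N); (- 2, [:: 2]%N)]
  | 3, 1 => Some [:: (1, [:: 1; 3]%N); (2, [:: 3]%N)]
  | 3, 2 => Some [:: (1, [:: 2; 3]%N); (- 1, [:: 1]%N)]
  | 4, 1 => Some [:: (1, [:: 1; 4]%N)]
  | 5, 1 => Some [:: (1, [:: 1; 5]%N); (- 2, [:: 5]%N)]
  | 6, 1 => Some [:: (1, [:: 1; 6]%N); (2, [:: 6]%N)]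
  | 4, 2 => Some [:: (1, [:: 2; 4]%N); (2, [:: 5]%N)]
  | 5, 2 => Some [:: (1, [:: 2; 5]%N)]
  | 6, 2 => Some [:: (1, [:: 2; 6]%N); (- 1, [:: 4]%N)]
  | 4, 3 => Some [:: (1, [:: 3; 4]%N); (- 2, [:: 6]%N)]
  | 5, 3 => Some [:: (1, [:: 3; 5]%N); (1, [:: 4]%N)]
  | 6, 3 => Some [:: (1, [:: 3; 6]%N)]
  | _, _ => None
  end.

Definition yrule (y x : nat) : option npoly :=
  if x == 0%N then (if y == 0%N then None else Some [:: (1, [:: 0%N; y])])
  else if (y <= 6)%N then (if (x <= 6)%N then ylet_rule 0 y x else None)
  else if (x <= 6)%N then Some [:: (1, [:: x; y])]
  else ylet_rule 6 (y - 6) (x - 6).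

Definition nbr x y := NA (NM x y) (NN (NM y x)).

Section CoproductRelations.
Variables (C : numFieldType) (A : algType {poly C}).
Variables (b : A) (X1 X2 : ygen -> A).

Definition yletter (i : nat) : A :=
  match i with
  | 0 => b
  | 1 => X1 gH | 2 => X1 gEp | 3 => X1 gEm
  | 4 => X1 gHh | 5 => X1 gEph | 6 => X1 gEmh
  | 7 => X2 gH | 8 => X2 gEp | 9 => X2 gEm
  | 10 => X2 gHh | 11 => X2 gEph | 12 => X2 gEmh
  | _ => 0
  end.

Definition ysat (X : ygen -> A) : Prop := forall x y,
  @yangian_rel C x y -> term_eval (in_alg A) X x = term_eval (in_alg A) X y.

Lemma in_algN1M (x : A) : in_alg A (- 1) * x = - x.
Proof. by rewrite rmorphN rmorph1 mulN1r. Qed.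

Lemma in_alg2M (x : A) : in_alg A 2 * x = x + x.
Proof. by rewrite rmorphMn rmorph1 mulrDl mul1r. Qed.

Lemma ysat_swap X (hX : ysat X) : 
  (X gEp * X gH = X gH * X gEp - (X gEp + X gEp)) *
  (X gEm * X gH = X gH * X gEm + (X gEm + X gEm)) *
  (X gEm * X gEp = X gEp * X gEm - X gH) *
  (X gHh * X gH = X gH * X gHh) *
  (X gEph * X gH = X gH * X gEph - (X gEph + X gEph)) *
  (X gEmh * X gH = X gH * X gEmh + (X gEmh + X gEmh)) *
  (X gHh * X gEp = X gEp * X gHh + (X gEph + X gEph)) *
  (X gEph * X gEp = X gEp * X gEph) *
  (X gEmh * X gEp = X gEp * X gEmh - X gHh) *
  (X gHh * X gEm = X gEm * X gHh - (X gEmh + X gEmh)) *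
  (X gEph * X gEm = X gEm * X gEph + X gHh) *
  (X gEmh * X gEm = X gEm * X gEmh).
Proof.
have sw (x y z : A) : x + in_alg A (- 1) * y = z -> x = y + z.
  by rewrite rmorphN rmorph1 mulN1r => <-; rewrite addrC subrK.
have sw' (x y z : A) : x + in_alg A (- 1) * y = z -> y = x - z.
  by move/sw=> ->; rewrite addrK.
have n1 (x : A) : in_alg A (- 1) * x = - x by rewrite rmorphN rmorph1 mulN1r.
have n2 (x : A) : in_alg A 2 * x = x + x by rewrite rmorphMn rmorph1 mulrDl mul1r.
have n0 := @scale0r {poly C} A.
do ![split]; [move: (hX _ _ (yrel_HE C)) | move: (hX _ _ (yrel_HF C))
 | move: (hX _ _ (yrel_EF C)) | move: (hX _ _ (yrel_HHh C))
 | move: (hX _ _ (yrel_HEh C)) | move: (hX _ _ (yrel_HFh C))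
 | move: (hX _ _ (yrel_HhE C)) | move: (hX _ _ (yrel_EEh C))
 | move: (hX _ _ (yrel_EFh C)) | move: (hX _ _ (yrel_HhF C))
 | move: (hX _ _ (yrel_FEh C)) | move: (hX _ _ (yrel_FFh C))];
 rewrite [LHS]/= [RHS]/=;
 (by move/sw' => ->; rewrite ?(n0, n2, n1, opprK, subr0))
 || (by move/sw => ->; rewrite ?(n0, n2, n1, opprK, addr0)).
Qed.

Hypotheses (bC : forall x, x * b = b * x).
Hypotheses (hX1 : ysat X1) (hX2 : ysat X2).
Hypothesis X12 : forall g h, X2 h * X1 g = X1 g * X2 h.

Lemma yruleP y x r :
  yrule y x = Some r -> yletter y * yletter x = pden yletter r.
Proof.
have e := (big_cons, big_nil, mulr1, addr0, mulr1z, mulrNz, addrA).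
have e1 := ysat_swap hX1; have e2 := ysat_swap hX2.
case: y => [|[|[|[|[|[|[|[|[|[|[|[|[|y]]]]]]]]]]]]];
case: x => [|[|[|[|[|[|[|[|[|[|[|[|[|x]]]]]]]]]]]]] //= [<-];
rewrite /pden /wden !e /= ?(mul0r, mulr0, X12, bC) //.
all: rewrite ?e1 ?e2 -?mulr2n ?opprD ?addrA.
all: by [].
Qed.

Hypothesis alphaE : in_alg A (alpha C) = b + b.

Definition ncoprod (g : ygen) : nexp :=
  let D i := NA (NV i) (NV (i + 6)) in
  let W i j := NA (NM (NV i) (NV (j + 6))) (NN (NM (NV j) (NV (i + 6)))) in
  match g with
  | gH => D 1%N | gEp => D 2%N | gEm => D 3%N
  | gEph => NA (D 5%N) (NM (NV 0) (W 2%N 1%N))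
  | gEmh => NA (D 6%N) (NN (NM (NV 0) (W 3%N 1%N)))
  | gHh => NA (D 4%N) (NN (NM (NA (NV 0) (NV 0)) (W 2%N 3%N)))
  end.

Definition nserreL (X : ygen -> nexp) := nbr (X gHh) (nbr (X gEph) (X gEmh)).
Definition nserreR (X : ygen -> nexp) := let a := NA (NV 0) (NV 0) in
  NM (NM a a) (NM (NA (NM (X gEmh) (X gEp)) (NN (NM (X gEm) (X gEph)))) (X gH)).

Definition ngen (o : nat) (g : ygen) : nexp :=
  NV (o + match g with gH => 1 | gEp => 2 | gEm => 3 | gHh => 4 | gEph => 5
          | gEmh => 6 end)%N.

Lemma ycst :
  [/\ forall x : A, in_alg A (- 1) * x = - x, forall x : A, in_alg A 2 * x = x + x,
      in_alg A 0 = 0 & in_alg A (alpha C ^+ 2) = (b + b) * (b + b)].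
Proof.
split=> [x|x||]; first by rewrite rmorphN rmorph1 mulN1r.
- by rewrite rmorphMn rmorph1 mulrDl mul1r.
- exact: rmorph0.
- by rewrite -alphaE -rmorphM expr2.
Qed.

Lemma ysat_serre X (Y : ygen -> nexp) : (forall g, nden yletter (Y g) = X g) ->
  ysat X -> nden yletter (nserreL Y) = nden yletter (nserreR Y).
Proof.
move=> XY /(_ _ _ (yrel_serre C)); have [] := ycst; set f := in_alg A.
by move=> n1 _ _ n2; rewrite /= !XY !n1 n2.
Qed.

Lemma ysat_coprod : ysat (fun g => nden yletter (ncoprod g)).
Proof.
pose Y := ncoprod; have nP := nnormP (n := 60) yruleP.
pose z := NA (NV 0) (NN (NV 0)).
have z0 : nden yletter z = 0 by rewrite /= subrr.
have s1 : nden yletter (nserreL (ngen 0)) = nden yletter (nserreR (ngen 0)).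
  by apply: ysat_serre hX1; case.
have s2 : nden yletter (nserreL (ngen 6)) = nden yletter (nserreR (ngen 6)).
  by apply: ysat_serre hX2; case.
move=> x y; have [] := ycst; set f := in_alg A => n1 n2 n0 na; case;
 cbn [term_eval term_com]; rewrite ?n1 ?n2 ?n0 ?na -?z0.
- by apply: (nP (nbr (Y gH) (Y gEp)) (NA (Y gEp) (Y gEp))); vm_compute.
- by apply: (nP (nbr (Y gH) (Y gEm)) (NN (NA (Y gEm) (Y gEm)))); vm_compute.
- by apply: (nP (nbr (Y gEp) (Y gEm)) (Y gH)); vm_compute.
- by apply: (nP (nbr (Y gH) (Y gEph)) (NA (Y gEph) (Y gEph))); vm_compute.
- by apply: (nP (nbr (Y gH) (Y gEmh)) (NN (NA (Y gEmh) (Y gEmh)))); vm_compute.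
- by apply: (nP (nbr (Y gHh) (Y gEp)) (NA (Y gEph) (Y gEph))); vm_compute.
- by apply: (nP (nbr (Y gHh) (Y gEm)) (NN (NA (Y gEmh) (Y gEmh)))); vm_compute.
- by apply: (nP (nbr (Y gEp) (Y gEmh)) (Y gHh)); vm_compute.
- by apply: (nP (nbr (Y gEm) (Y gEph)) (NN (Y gHh))); vm_compute.
- by apply: (nP (nbr (Y gH) (Y gHh)) z); vm_compute.
- by apply: (nP (nbr (Y gEp) (Y gEph)) z); vm_compute.
- by apply: (nP (nbr (Y gEm) (Y gEmh)) z); vm_compute.
- have h : nden yletter (NA (nserreL Y) (NN (NA (nserreL (ngen 0)) (nserreL (ngen 6)))))
    = nden yletter (NA (nserreR Y) (NN (NA (nserreR (ngen 0)) (nserreR (ngen 6))))).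
    by apply: nP; vm_compute.
  have cancel2 a b1 b2 c d1 d2 : nden yletter (NA a (NN (NA b1 b2))) =
      nden yletter (NA c (NN (NA d1 d2))) -> nden yletter b1 = nden yletter d1 ->
      nden yletter b2 = nden yletter d2 -> nden yletter a = nden yletter c.
    by move=> hac h1 h2; move: hac; rewrite /= h1 h2 => /addIr.
  exact: cancel2 h s1 s2.
Qed.
End CoproductRelations.

Section Coproduct.
Variable C : numFieldType.
Local Notation k := {poly C}.
Local Notation Y := (yangian C).
Local Notation Y2 := (yangian2 C).

Lemma yg_eval (x : term k ygen) : term_eval (in_alg Y) (@yg C) x = pcls _ x.
Proof.
elim: x => //= [c|x -> y ->|x -> y ->]; last by rewrite pclsM.
- by rewrite pcls_cst.
- by rewrite pclsD.
Qed.

Lemma yg_sat : ysat (@yg C).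
Proof. by move=> x y h; rewrite !yg_eval; apply: pcls_rel. Qed.

Lemma ysat_comp (phi : Y -> Y2) : zmod_morphism phi -> monoid_morphism phi ->
  (forall c, phi (c%:A) = c%:A) -> ysat (phi \o @yg C).
Proof.
move=> phiB [_ phiM] phiA.
have phi0 : phi 0 = 0 by have := phiB 0 0; rewrite !subrr.
have phiN y : phi (- y) = - phi y by have := phiB 0 y; rewrite phi0 !sub0r.
have phiD x y : phi (x + y) = phi x + phi y.
  by have := phiB x (- y); rewrite phiN !opprK.
have e x : term_eval (in_alg Y2) (phi \o @yg C) x = phi (term_eval (in_alg Y) (@yg C) x).
  by elim: x => //= x -> y ->.
by move=> x y /yg_sat; rewrite !e => ->.
Qed.

Fact coprod_model :
  presented_model (@yangian_rel C) (in_alg Y2) (@coprod_gen C).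
Proof.
split=> [c x|x y h]; first by rewrite mulr_algl mulr_algr.
pose b : Y2 := in_alg Y2 (2^-1 *: alpha C).
pose X1 g : Y2 := yg C g ⊗ 1; pose X2 g : Y2 := 1 ⊗ yg C g.
have tN (x' y' : Y) : (- x') ⊗ y' = - (x' ⊗ y').
  by rewrite -scaleN1r tpureZl scaleN1r.
have tN' (x' y' : Y) : x' ⊗ (- y') = - (x' ⊗ y').
  by rewrite -scaleN1r tpureZr scaleN1r.
have h1 : ysat X1.
  apply: (@ysat_comp (fun x => x ⊗ 1)) => [x' y'||c].
  - by rewrite tpureDl tN.
  - by split=> [|x' y']; rewrite ?tpure11 // tpureM mulr1.
  - by rewrite tpureZl tpure11.
have h2 : ysat X2.
  apply: (@ysat_comp (fun x => 1 ⊗ x)) => [x' y'||c].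
  - by rewrite tpureDr tN'.
  - by split=> [|x' y']; rewrite ?tpure11 // tpureM mulr1.
  - by rewrite tpureZr tpure11.
have bC z : z * b = b * z by rewrite mulr_algl mulr_algr.
have X12 g g' : X2 g' * X1 g = X1 g * X2 g' by rewrite !tpureM !mul1r !mulr1.
have two : 2^-1 + 2^-1 = 1 :> C by rewrite -mulr2n -[_ *+ 2]mulr_natl mulfV ?pnatr_eq0.
have aE : in_alg Y2 (alpha C) = b + b.
  by rewrite -rmorphD -scalerDl two scale1r.
have eb z : (2^-1 *: alpha C) *: z = b * z by rewrite mulr_algl.
have ea z : alpha C *: z = (b + b) * z by rewrite -aE mulr_algl.
have tE g g' : yg C g ⊗ yg C g' = X1 g * X2 g' by rewrite tpureM mulr1 mul1r.
have e g : coprod_gen C g = nden (yletter b X1 X2) (ncoprod g).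
  by case: g; rewrite /= ?eb ?ea ?tE.
have ee z : term_eval (in_alg Y2) (@coprod_gen C) z
    = term_eval (in_alg Y2) (fun g => nden (yletter b X1 X2) (ncoprod g)) z.
  by elim: z => //= z1 -> z2 ->.
by rewrite !ee; apply: (ysat_coprod bC h1 h2 X12 aE).
Qed.

HB.instance Definition _ :=
  GRing.isZmodMorphism.Build Y Y2 (@coprod C) (presented_map_zmod coprod_model).
HB.instance Definition _ :=
  GRing.isMonoidMorphism.Build Y Y2 (@coprod C)
    (presented_map_monoid coprod_model).

Lemma coprod_yg g : coprod (yg C g) = coprod_gen C g.
Proof. exact: (presented_map_cls coprod_model). Qed.

Lemma coprodZ (c : k) (x : Y) : coprod (c *: x) = c *: coprod x.
Proof. by rewrite /coprod (presented_mapZ coprod_model) mulr_algl. Qed.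

End Coproduct.

Notation "x %:F" := (@FracField.tofrac _ x) : ring_scope.

Section Evaluation.
Variable C : numFieldType.
Local Notation k := {poly C}.
Local Notation Y := (yangian C).
Local Notation L := {fraction {poly C}}.

(* Scalars p(alpha) act by p(1). *)
Definition ev_scalar (p : k) : 'M[L]_2 := ((p.[1])%:P%:F)%:M.

HB.instance Definition _ := GRing.RMorphism.copy ev_scalar
  ((scalar_mx : L -> 'M[L]_2) \o (@FracField.tofrac {poly C}) \o (@polyC C)
     \o horner_eval (1 : C)).

Definition ev_gen (w : L) (g : ygen) : 'M[L]_2 :=
  match g with
  | gEp => delta_mx 0 1
  | gEm => delta_mx 1 0
  | gH => delta_mx 0 0 - delta_mx 1 1
  | gEph => w *: delta_mx 0 1
  | gEmh => w *: delta_mx 1 0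
  | gHh => w *: (delta_mx 0 0 - delta_mx 1 1)
  end.

Definition ev_rep (w : L) : Y -> 'M[L]_2 := presented_map ev_scalar (ev_gen w).

Lemma ev_scalarC c (x : 'M[L]_2) : ev_scalar c * x = x * ev_scalar c.
Proof. by rewrite /ev_scalar -!mulmxE scalar_mxC. Qed.

Fact ev_model w : presented_model (@yangian_rel C) ev_scalar (ev_gen w).
Proof.
split=> [c x|x y]; first exact: ev_scalarC.
pose E : 'M[L]_2 := delta_mx 0 1; pose F : 'M[L]_2 := delta_mx 1 0.
pose H : 'M[L]_2 := delta_mx 0 0 - delta_mx 1 1.
have HE : H * E = E.
  by rewrite mulrBl -!mulmxE !mul_delta_mx_cond /= mulr0n subr0.
have EH : E * H = - E.
  by rewrite mulrBr -!mulmxE !mul_delta_mx_cond /= mulr0n sub0r.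
have HF : H * F = - F.
  by rewrite mulrBl -!mulmxE !mul_delta_mx_cond /= mulr0n sub0r.
have FH : F * H = F.
  by rewrite mulrBr -!mulmxE !mul_delta_mx_cond /= mulr0n subr0.
have EF : E * F - F * E = H by rewrite -!mulmxE !mul_delta_mx_cond.
have n1 z : ev_scalar (- 1) * z = - z by rewrite rmorphN rmorph1 mulN1r.
have n2 z : ev_scalar 2 * z = z + z by rewrite rmorphMn rmorph1 mulrDl mul1r.
have n0 : ev_scalar 0 = 0 by rewrite rmorph0.
have hl (z z' : 'M[L]_2) : (w *: z) * z' = w *: (z * z').
  by rewrite -!mulmxE scalemxAl.
have hr (z z' : 'M[L]_2) : z * (w *: z') = w *: (z * z').
  by rewrite -!mulmxE scalemxAr.
case; cbn [term_eval term_com]; rewrite ?n1 ?n2 ?n0 [ev_gen]lock /= -?lock /=;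
  rewrite -/E -/F -/H.
- by rewrite HE EH opprK.
- by rewrite HF FH opprD.
- exact: EF.
- by rewrite hr hl HE EH scalerN opprK.
- by rewrite hr hl HF FH scalerN opprD.
- by rewrite hr hl HE EH scalerN opprK.
- by rewrite hr hl HF FH scalerN opprD.
- by rewrite hr hl -scalerBr EF.
- by rewrite hr hl -scalerBr -scalerN -EF opprB.
- by rewrite hr hl subrr [RHS]n0.
- by rewrite hr hl subrr [RHS]n0.
- by rewrite hr hl subrr [RHS]n0.
- have -> : w *: E * (w *: F) - w *: F * (w *: E) = w *: (w *: H).
    by rewrite !hl !hr -!scalerBr EF.
  have -> : w *: F * E - F * (w *: E) = 0 by rewrite hl hr subrr.
  by rewrite mul0r mulr0 !hl !hr subrr.
Qed.

HB.instance Definition _ w :=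
  GRing.isZmodMorphism.Build Y 'M[L]_2 (ev_rep w) (presented_map_zmod (ev_model w)).
HB.instance Definition _ w :=
  GRing.isMonoidMorphism.Build Y 'M[L]_2 (ev_rep w)
    (presented_map_monoid (ev_model w)).

Lemma ev_rep_yg w g : ev_rep w (yg C g) = ev_gen w g.
Proof. exact: (presented_map_cls (ev_model w)). Qed.

Lemma ev_repZ w (c : k) (x : Y) : ev_rep w (c *: x) = ev_scalar c * ev_rep w x.
Proof. exact: (presented_mapZ (ev_model w)). Qed.

Lemma ev_rep_scalar w (c : k) : ev_rep w (c%:A) = ev_scalar c.
Proof. by rewrite ev_repZ rmorph1 mulr1. Qed.

(* T_w ⊗ counit, followed by the identification M_2 ⊗ C[alpha] = M_2 in which
   alpha is specialized to 1 in both factors. *)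
Definition ev_tens_counit (w : L) : yangian2 C -> 'M[L]_2 :=
  tens_map ev_scalar (ev_rep w) (ev_scalar \o @counit C).

Fact ev_tens_counit_model w : presented_model (@tens_rel k Y Y) ev_scalar
  (fun x => match x with inl a => ev_rep w a | inr b => (ev_scalar \o @counit C) b end).
Proof.
apply: tens_model => [c x|c|c|a b].
- exact: ev_scalarC.
- exact: ev_rep_scalar.
- by rewrite [LHS]/= counit_scalar.
- exact: esym (ev_scalarC _ _).
Qed.

HB.instance Definition _ w :=
  GRing.isZmodMorphism.Build (yangian2 C) 'M[L]_2 (ev_tens_counit w)
    (presented_map_zmod (ev_tens_counit_model w)).
HB.instance Definition _ w :=
  GRing.isMonoidMorphism.Build (yangian2 C) 'M[L]_2 (ev_tens_counit w)
    (presented_map_monoid (ev_tens_counit_model w)).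

Lemma ev_tens_counitE w (a b : Y) :
  ev_tens_counit w (a ⊗ b) = ev_rep w a * ev_scalar (counit b).
Proof.
apply: (@tens_mapE k Y Y _ ev_scalar (ev_rep w) (ev_scalar \o @counit C)).
- exact: ev_scalarC.
- exact: ev_rep_scalar.
- by move=> c; rewrite [LHS]/= counit_scalar.
- by move=> *; exact: esym (ev_scalarC _ _).
Qed.

Lemma ev_tens_counitZ w (c : k) (x : yangian2 C) :
  ev_tens_counit w (c *: x) = ev_scalar c * ev_tens_counit w x.
Proof. exact: (presented_mapZ (ev_tens_counit_model w)). Qed.

End Evaluation.


Section TwistedYangian.
Variable C : numFieldType.
Local Notation k := {poly C}.
Local Notation Y := (yangian C).
Local Notation L := {fraction {poly C}}.
Local Notation E := (yg C gEp).
Local Notation F := (yg C gEm).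
Local Notation H := (yg C gH).

Definition tw_Ep (t : C) : Y :=
  yg C gEph + (t *: alpha C) *: E + (4^-1 *: alpha C) *: (E * H + H * E).

Definition tw_Em (t : C) : Y :=
  yg C gEmh - (t *: alpha C) *: F - (4^-1 *: alpha C) *: (F * H + H * F).

Definition twisted_yangian (t : C) : Y -> Prop :=
  subalg_gen (fun x => [\/ x = H, x = tw_Ep t | x = tw_Em t]).

Definition in_tens_span (B : Y -> Prop) (z : yangian2 C) : Prop :=
  exists s : seq (Y * Y), (forall p, p \in s -> B p.2) /\ z = \sum_(p <- s) p.1 ⊗ p.2.

Lemma in_tens_pure (B : Y -> Prop) x y : B y -> in_tens_span B (x ⊗ y).
Proof.
by exists [:: (x, y)]; rewrite big_seq1; split=> // p; rewrite inE => /eqP ->.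
Qed.

Lemma in_tensD (B : Y -> Prop) z z' :
  in_tens_span B z -> in_tens_span B z' -> in_tens_span B (z + z').
Proof.
move=> [s [sB ->]] [s' [sB' ->]]; exists (s ++ s'); rewrite big_cat; split=> //.
by move=> p; rewrite mem_cat => /orP [/sB|/sB'].
Qed.

Lemma in_tensM (B : Y -> Prop) z z' : (forall x y, B x -> B y -> B (x * y)) ->
  in_tens_span B z -> in_tens_span B z' -> in_tens_span B (z * z').
Proof.
move=> BM [s [sB ->]] [s' [sB' ->]].
exists [seq (p.1 * q.1, p.2 * q.2) | p <- s, q <- s']; split.
  by move=> _ /allpairsP [[p q] [/sB hp /sB' hq ->]]; apply: BM.
rewrite big_allpairs_dep mulr_suml; apply: eq_bigr => p _.
by rewrite mulr_sumr; apply: eq_bigr => q _; rewrite tpureM.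
Qed.

Lemma coideal_identity (A : pzRingType) (a b c d q : A) :
  d * a = a * d -> b * c = c * b ->
  (q + q) * (a * d - c * b) + q * ((a + b) * (c + d) + (c + d) * (a + b))
  = q * (a * c + c * a) + q * (b * d + d * b) + (q + q + (q + q)) * (a * d).
Proof.
move=> da bc; pose e i := nth 0 [:: a; b; c; d; q] i.
pose r y x : option npoly := match y, x with
  | 3, 0 => Some [:: (1, [:: 0; 3]%N)] | 1, 2 => Some [:: (1, [:: 2; 1]%N)]
  | _, _ => None end.
have rP y x p : r y x = Some p -> e y * e x = pden e p.
  case: y => [|[|[|[|y]]]] //; case: x => [|[|[|x]]] //= [<-];
  by rewrite /pden big_seq1 /wden big_cons big_seq1.
pose a' := NV 0; pose b' := NV 1; pose c' := NV 2; pose d' := NV 3; pose q' := NV 4.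
apply: (nnormP (n := 10) rP
  (x := NA (NM (NA q' q') (NA (NM a' d') (NN (NM c' b'))))
           (NM q' (NA (NM (NA a' b') (NA c' d')) (NM (NA c' d') (NA a' b')))))
  (y := NA (NA (NM q' (NA (NM a' c') (NM c' a'))) (NM q' (NA (NM b' d') (NM d' b'))))
           (NM (NA (NA q' q') (NA q' q')) (NM a' d')))).
by vm_compute.
Qed.

Definition left_coideal (B : Y -> Prop) : Prop :=
  forall b, B b -> in_tens_span B (coprod b).

Lemma twisted_yangian_left_coideal t : left_coideal (twisted_yangian t).
Proof.
pose B := twisted_yangian t.
have B1 : B 1.
  have := @subalg_scal k Y (fun x => [\/ x = H, x = tw_Ep t | x = tw_Em t]) 1.
  by rewrite scale1r.
have BH : B H by apply: subalg_base; constructor 1.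
have T1 x : in_tens_span B (x ⊗ 1) by apply: in_tens_pure.
have T2 y : B y -> in_tens_span B (1 ⊗ y) by apply: in_tens_pure.
have half : 2^-1 *: alpha C = 4^-1 *: alpha C + 4^-1 *: alpha C.
  have four : 4 = 2 * 2 :> C by rewrite -natrM.
  rewrite -scalerDl -mulr2n -[_^-1 *+ 2]mulr_natl four invfM mulrA mulfV ?mul1r //.
  by rewrite pnatr_eq0.
have quarter : alpha C = 2^-1 *: alpha C + 2^-1 *: alpha C.
  by rewrite -scalerDl -mulr2n -[_^-1 *+ 2]mulr_natl mulfV ?pnatr_eq0 // scale1r.
pose q : yangian2 C := in_alg (yangian2 C) (4^-1 *: alpha C).
have qE z : (4^-1 *: alpha C) *: z = q * z by rewrite mulr_algl.
have hE z : (2^-1 *: alpha C) *: z = (q + q) * z.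
  by rewrite half scalerDl !qE mulrDl.
have aE z : alpha C *: z = (q + q + (q + q)) * z.
  by rewrite {1}quarter scalerDl !hE -mulrDl.
have tN (x y : Y) : (- x) ⊗ y = - (x ⊗ y) by rewrite -scaleN1r tpureZl scaleN1r.
have tN' (x y : Y) : x ⊗ (- y) = - (x ⊗ y) by rewrite -scaleN1r tpureZr scaleN1r.
have tE (x y : Y) : x ⊗ y = (x ⊗ 1) * (1 ⊗ y) by rewrite tpureM mulr1 mul1r.
have tE' (x y : Y) : x ⊗ y = (1 ⊗ y) * (x ⊗ 1) by rewrite tpureM mulr1 mul1r.
have t1M (x y : Y) : (x * y) ⊗ 1 = (x ⊗ 1) * (y ⊗ 1) :> yangian2 C by rewrite tpureM mulr1.
have t2M (x y : Y) : 1 ⊗ (x * y) = (1 ⊗ x) * (1 ⊗ y) :> yangian2 C by rewrite tpureM mulr1.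
have idE (x y : Y) : (2^-1 *: alpha C) *: (x ⊗ y - y ⊗ x) +
   (4^-1 *: alpha C) *: ((x ⊗ 1 + 1 ⊗ x) * (y ⊗ 1 + 1 ⊗ y) + (y ⊗ 1 + 1 ⊗ y) * (x ⊗ 1 + 1 ⊗ x))
   = (4^-1 *: alpha C) *: ((x * y + y * x) ⊗ 1) + (4^-1 *: alpha C) *: (1 ⊗ (x * y + y * x))
     + (alpha C *: x) ⊗ y.
  rewrite tpureZl aE hE !qE tpureDl tpureDr !t1M !t2M (tE x y) (tE y x).
  by apply: coideal_identity; rewrite -tE -tE'.
have cM (x y : Y) : coprod (x * y) = coprod x * coprod y by exact: rmorphM.
have cD (x y : Y) : coprod (x + y) = coprod x + coprod y by exact: rmorphD.
have cN (x : Y) : coprod (- x) = - coprod x by exact: rmorphN.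
move=> b; elim=> {b} [b|c|x y _ hx _ hy|x y _ hx _ hy].
- case=> ->.
  + by rewrite coprod_yg; apply: in_tensD; [apply: T1|apply: T2].
  + have -> : coprod (tw_Ep t) = tw_Ep t ⊗ 1 + 1 ⊗ tw_Ep t + (alpha C *: E) ⊗ H.
      rewrite /tw_Ep !cD !coprodZ !cD !cM !coprod_yg /=.
      rewrite !tpureDl !tpureDr !tpureZl !tpureZr [LHS]addrAC.
      rewrite -[_ + (2^-1 *: alpha C) *: _ + _]addrA idE.
      rewrite [in RHS]addrACA [X in _ = X + _ + _]addrACA -[RHS]addrA [LHS]addrAC.
      by rewrite scalerDr !tpureZl.
    by apply: in_tensD (in_tens_pure _ BH); apply: in_tensD; [apply: T1|apply/T2/subalg_base; constructor 2].
  + have -> : coprod (tw_Em t) = tw_Em t ⊗ 1 + 1 ⊗ tw_Em t + (- (alpha C *: F)) ⊗ H.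
      rewrite /tw_Em !(cD, cN) !coprodZ !cD !cM !coprod_yg /=.
      rewrite !(tpureDl, tpureDr, tN, tN') !tpureZl !tpureZr [LHS]addrAC.
      rewrite -[_ - (2^-1 *: alpha C) *: _ - _]addrA -opprD idE.
      rewrite [in RHS]addrACA [X in _ = X + _ + _]addrACA -[RHS]addrA [LHS]addrAC.
      by rewrite scalerDr !tpureZl !opprD.
    by apply: in_tensD (in_tens_pure _ BH); apply: in_tensD; [apply: T1|apply/T2/subalg_base; constructor 3].
- by rewrite coprodZ rmorph1 -tpure11 -tpureZl; apply: T1.
- by rewrite cD; apply: in_tensD.
- by rewrite cM; apply: in_tensM => // *; apply: subalg_mul.
Qed.

(* The spectral parameter u is the variable 'X of C(u). *)
Definition intertwines (t : C) (K : 'M[L]_2) : Prop :=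
  forall b, twisted_yangian t b ->
    ev_tens_counit (- 'X%:F) (coprod b) *m K = K *m ev_tens_counit ('X%:F) (coprod b).

End TwistedYangian.

(* The map of fraction fields induced by an injective ring morphism f. *)
Definition frac_map (A B : idomainType) (f : A -> B) (x : {fraction A}) : {fraction B} :=
  (f \n_(repr x))%:F / (f \d_(repr x))%:F.

Section FracMap.
Variables (A B : idomainType) (f : {rmorphism A -> B}).
Hypothesis f_inj : injective f.

Lemma frac_map_ratio (x : {ratio A}) :
  frac_map f (\pi_{fraction A} x) = (f \n_x)%:F / (f \d_x)%:F.
Proof.
have d0 (y : {ratio A}) : (f \d_y)%:F != 0.
  by rewrite tofrac_eq0 -(rmorph0 f) (inj_eq f_inj) denom_ratioP.
rewrite /frac_map; set y := repr _.
have /eqP h : y == x %[mod {fraction A}] by rewrite reprK.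
apply/eqP; rewrite eqr_div // -!tofracM tofrac_eq -!rmorphM (inj_eq f_inj).
move/eqP: h; rewrite FracField.equivf_def => /eqP ->.
by rewrite mulrC.
Qed.

Lemma frac_mapE (n d : A) : d != 0 ->
  frac_map f (n%:F / d%:F) = (f n)%:F / (f d)%:F.
Proof.
move=> d0; have -> : n%:F / d%:F = \pi_{fraction A} (Ratio n d).
  have dF0 : d%:F != 0 by rewrite tofrac_eq0.
  apply: (mulIf dF0); rewrite mulfVK // !piE; apply/eqmodP.
  by rewrite /= FracField.equivfE /FracField.mulf !numden_Ratio ?mulr1 ?mul1r ?oner_neq0.
by rewrite frac_map_ratio !numden_Ratio.
Qed.
End FracMap.

(* The R-matrix in the basis v1⊗v1, v1⊗v2, v2⊗v1, v2⊗v2. *)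
Definition Rmat (K : fieldType) (w : K) : 'M[K]_(2 * 2) :=
  let r := w / (w - 1) in
  \matrix_(i, j) nth 0 (nth [::]
    [:: [:: 1; 0; 0; 0];
        [:: 0; r; 1 - r; 0];
        [:: 0; 1 - r; r; 0];
        [:: 0; 0; 0; 1]] i) j.

(* The variable u is the inner one in C(u,v) = Frac(C[u][v]). *)
Definition reflection_equation (C : numFieldType) (K : 'M[{fraction {poly C}}]_2) : Prop :=
  let u : {fraction {poly {poly C}}} := 'X%:P%:F in
  let v : {fraction {poly {poly C}}} := 'X%:F in
  let K1 := map_mx (frac_map (@polyC {poly C})) K *t 1%:M in
  let K2 := 1%:M *t map_mx (frac_map (map_poly (@polyC C))) K in
  Rmat (u - v) *m K1 *m Rmat (u + v) *m K2 = K2 *m Rmat (u + v) *m K1 *m Rmat (u - v).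

(* Main.v *)
(* On C^2 the operator E H + H E is 0, so (T_w ⊗ counit) Δ sends H, tw_Ep and
   tw_Em to sigma_z, (w + t) e_12 and (w - t) e_21.  Commuting with sigma_z makes
   K diagonal, and the other two generators both say that
   (t + u) K_11 = (t - u) K_22; hence K = diag(t - u, t + u) up to a scalar.
   For this K the reflection equation is an entrywise identity of rational
   functions. *)
Require Import Defs.
From mathcomp Require Import all_boot all_order all_algebra.
From mathcomp Require Import reals complex.
From mathcomp Require Import mxtens ring.

Import GRing.Theory Num.Theory.
Local Open Scope ring_scope.

(** Kept over an arbitrary field so that the same formula serves over C(u) and, after extending
    scalars, over C(u,v). *)
Definition singlet_K {K : fieldType} (t w : K) : 'M[K]_2 :=
  diag_mx (\row_i (if i == 0 then t - w else t + w)).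

(** In the ordered basis of the tensor square both [K1] and [K2] are diagonal, so in the reflection
    equation they only rescale rows and columns of [Rmat]. *)
Lemma tens1_diag (K : fieldType) (d : 'rV[K]_2) :
  1%:M *t diag_mx d
  = diag_mx (\row_(i < 2 * 2) nth 0 [:: d 0 0; d 0 1; d 0 0; d 0 1] i).
Proof.
apply/matrixP; case=> [[|[|[|[|i]]]] hi] //; case=> [[|[|[|[|j]]]] hj] //.
all: rewrite !mxE -!val_eqE /= ?mulr0n ?mulr1n ?mul1r ?mul0r //.
all: by congr (d 0 _); apply/val_inj.
Qed.

Lemma tens_diag1 (K : fieldType) (d : 'rV[K]_2) :
  diag_mx d *t 1%:M
  = diag_mx (\row_(i < 2 * 2) nth 0 [:: d 0 0; d 0 0; d 0 1; d 0 1] i).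
Proof.
apply/matrixP; case=> [[|[|[|[|i]]]] hi] //; case=> [[|[|[|[|j]]]] hj] //.
all: rewrite !mxE -!val_eqE /= ?mulr0n ?mulr1n ?mulr1 ?mulr0 //.
all: by congr (d 0 _); apply/val_inj.
Qed.

(** The two hypotheses say that the denominators of the R-matrices at [u - v] and [u + v] do not
    vanish; each of the 16 entries is then a field identity. *)
Lemma singlet_K_reflection (K : fieldType) (t u v : K) :
  u - v - 1 != 0 -> u + v - 1 != 0 ->
  let K1 := singlet_K t u *t 1%:M in
  let K2 := 1%:M *t singlet_K t v in
  Rmat (u - v) *m K1 *m Rmat (u + v) *m K2
  = K2 *m Rmat (u + v) *m K1 *m Rmat (u - v).
Proof.
move=> m0 p0; rewrite /= /singlet_K tens_diag1 tens1_diag mul_diag_mx !mul_mx_diag.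
apply/matrixP; case=> [[|[|[|[|i]]]] hi] //; case=> [[|[|[|[|j]]]] hj] //.
all: rewrite !mxE !big_ord_recl !big_ord0 /= !mxE /=.
all: field; rewrite ?m0 ?p0 //.
Qed.

Lemma frac_map_tofrac (A B : idomainType) (f : {rmorphism A -> B}) (x : A) :
  injective f -> frac_map f x%:F = (f x)%:F.
Proof.
move=> f_inj; have := frac_mapE f_inj x (oner_neq0 A).
by rewrite !rmorph1 !divr1.
Qed.

(** Meant for [f] a [frac_map], whose values are known on polynomials: the three hypotheses are
    instances of that and cover all the entries. *)
Lemma map_singlet_K (K L : fieldType) (f : K -> L) (t w : K) :
  f 0 = 0 -> f (t - w) = f t - f w -> f (t + w) = f t + f w ->
  map_mx f (singlet_K t w) = singlet_K (f t) (f w).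
Proof.
move=> f0 fB fD; apply/matrixP=> i j; rewrite !mxE.
by case: (i == j); rewrite ?mulr0n // !mulr1n; case: (i == 0).
Qed.

Section Evaluation.
Variable C : numFieldType.
Local Notation L := {fraction {poly C}}.

(** The counit kills every generator, hence also the [alpha] corrections, whose second tensor
    factors are generators; only [yg C g ⊗ 1] survives. *)
Lemma ev_tens_counit_coprod_yg (w : L) (g : ygen) :
  ev_tens_counit w (coprod (yg C g)) = ev_gen w g.
Proof.
have s0 : ev_scalar (0 : {poly C}) = 0 by rewrite rmorph0.
have s1 : ev_scalar (1 : {poly C}) = 1 by rewrite rmorph1.
rewrite coprod_yg; case: g; rewrite [LHS]/= ?(rmorphB, rmorphD) /=;
  rewrite ?ev_tens_counitZ ?(rmorphB, rmorphD) /=;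
  rewrite !ev_tens_counitE ?counit_gen ?(rmorph1 (@counit C));
  by rewrite !ev_rep_yg ?s0 ?s1 ?mulr1 ?mulr0 ?subr0 ?addr0 ?mulr0 ?subr0 ?addr0.
Qed.

Lemma ev_tens_counit_coprodZ (w : L) (c : {poly C}) (x : yangian C) :
  ev_tens_counit w (coprod (c *: x))
  = c.[1]%:P%:F *: ev_tens_counit w (coprod x).
Proof. by rewrite coprodZ ev_tens_counitZ /ev_scalar -mulmxE mul_scalar_mx. Qed.

Lemma ev_tens_counit_tw_Ep (w : L) (t : C) :
  ev_tens_counit w (coprod (tw_Ep t)) = (w + t%:P%:F) *: delta_mx 0 1.
Proof.
rewrite /tw_Ep !rmorphD /= !ev_tens_counit_coprodZ !rmorphD !rmorphM /=.
rewrite !ev_tens_counit_coprod_yg /=.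
(* Matrix units give E H = -E and H E = E, so the symmetrized product cancels; then [alpha] is
   specialized to 1. *)
rewrite mulrBr mulrBl -!mulmxE !mul_delta_mx_cond /= !mulr0n !mulr1n sub0r subr0.
by rewrite addNr scaler0 addr0 /alpha !hornerE scalerDl.
Qed.

Lemma ev_tens_counit_tw_Em (w : L) (t : C) :
  ev_tens_counit w (coprod (tw_Em t)) = (w - t%:P%:F) *: delta_mx 1 0.
Proof.
rewrite /tw_Em !rmorphB /= !ev_tens_counit_coprodZ !rmorphD !rmorphM /=.
rewrite !ev_tens_counit_coprod_yg /=.
rewrite mulrBr mulrBl -!mulmxE !mul_delta_mx_cond /= !mulr0n !mulr1n sub0r subr0.
by rewrite subrr scaler0 subr0 /alpha !hornerE scalerBl.
Qed.

(** The evaluations at -u and u are ring morphisms that agree on scalars, so the elements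
    intertwined by [K] form a subalgebra. *)
Lemma intertwines_generators (t : C) (K : 'M[L]_2) :
  (forall x, [\/ x = yg C gH, x = tw_Ep t | x = tw_Em t] ->
    ev_tens_counit (- 'X%:F) (coprod x) *m K
    = K *m ev_tens_counit ('X%:F) (coprod x)) ->
  intertwines t K.
Proof.
move=> hgen b; elim=> {b} [b|c|x y _ hx _ hy|x y _ hx _ hy]; first exact: hgen.
- rewrite !ev_tens_counit_coprodZ !rmorph1 /= -!scalemxAl -!scalemxAr.
  by rewrite mul1mx mulmx1.
- by rewrite !rmorphD mulmxDl mulmxDr hx hy.
- by rewrite !rmorphM -!mulmxE -mulmxA hy !mulmxA hx.
Qed.

Lemma intertwines_singlet_K (t : C) : intertwines t (singlet_K t%:P%:F 'X%:F).
Proof.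
apply: intertwines_generators => x [] ->.
all: rewrite ?(ev_tens_counit_coprod_yg, ev_tens_counit_tw_Ep, ev_tens_counit_tw_Em) /=.
all: apply/matrixP; case=> [[|[|i]] hi] //; case=> [[|[|j]] hj] //.
all: rewrite !mxE !big_ord_recl !big_ord0 /= !mxE /=; ring.
Qed.

Lemma singlet_K00_neq0 (t : C) : t%:P%:F - 'X%:F != 0 :> L.
Proof.
by rewrite -tofracB tofrac_eq0 -opprB oppr_eq0 polyXsubC_eq0.
Qed.

Lemma intertwines_singlet_K_unique (t : C) (K : 'M[L]_2) :
  intertwines t K -> exists c : L, K = c *: singlet_K t%:P%:F 'X%:F.
Proof.
move=> hK.
have two : 2 != 0 :> L.
  by rewrite -(rmorph_nat (@FracField.tofrac {poly C})) tofrac_eq0 -polyC_natr polyC_eq0 pnatr_eq0.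
have half (a : L) : a = - a -> a = 0.
  move/eqP; rewrite -addr_eq0 -mulr2n -mulr_natl mulf_eq0 (negPf two) /=.
  by move/eqP.
have H : twisted_yangian t (yg C gH) by apply: subalg_base; constructor 1.
have P : twisted_yangian t (tw_Ep t) by apply: subalg_base; constructor 2.
move/matrixP: (hK _ H) => hH; move/matrixP: (hK _ P) => /(_ 0 1) hP.
(* Commuting with sigma_z gives x = -x for both off-diagonal entries, hence 0 as 2 is invertible;
   [hP] reads (t - u) K_22 = K_11 (t + u) and fixes the ratio of the diagonal entries. *)
move: (hH 0 1) (hH 1 0) hP; rewrite !ev_tens_counit_coprod_yg !ev_tens_counit_tw_Ep.
have o0 : ord0 = 0 :> 'I_2 by apply/val_inj.
have l1 : lift ord0 ord0 = 1 :> 'I_2 by apply/val_inj.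
rewrite !mxE !big_ord_recl !big_ord0 /= !mxE /= l1 o0.
rewrite !(subr0, sub0r, subrr, mul0r, mulr0, add0r, addr0, mul1r, mulr1).
rewrite mulrN1 mulN1r => /half K01 /esym /half K10; rewrite [_ + t%:P%:F]addrC => K11.
have tX := singlet_K00_neq0 t; exists (K 0 0 / (t%:P%:F - 'X%:F)).
have K11E : K 1 1 = K 0 0 / (t%:P%:F - 'X%:F) * (t%:P%:F + 'X%:F).
  by rewrite mulrAC [_ + 'X%:F]addrC -K11 [_ * K 1 1]mulrC mulfK.
apply/matrixP=> i j; rewrite !mxE.
have I2 (l : 'I_2) : l = 0 \/ l = 1.
  by case: l => [[|[|l]] hl] //; [left|right]; apply/val_inj.
have [-> | ->] := I2 i; have [-> | ->] := I2 j; rewrite /= ?mulr0n ?mulr1n ?mulr0 //.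
by rewrite divfK.
Qed.

(** The two embeddings of C[u] into C[u][v] agree on the constant [t] and send the variable to u and
    v respectively, so the identity over a general field applies in C(u,v). *)
Lemma reflection_equation_singlet_K (t : C) :
  reflection_equation (singlet_K t%:P%:F 'X%:F).
Proof.
have map_polyC_inj : injective (map_poly (@polyC C)).
  exact: (map_inj_poly (@polyC_inj C) (polyC0 _)).
have f0 (f : {rmorphism {poly C} -> {poly {poly C}}}) :
    injective f -> map_mx (frac_map f) (singlet_K t%:P%:F 'X%:F)
                   = singlet_K (f t%:P)%:F (f 'X)%:F.
  move=> f_inj; rewrite map_singlet_K ?frac_map_tofrac //.
  - by rewrite !rmorph0.
  - by rewrite -tofracB frac_map_tofrac // rmorphB tofracB.
  - by rewrite -tofracD frac_map_tofrac // rmorphD tofracD.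
rewrite /reflection_equation !f0 //; last exact: polyC_inj.
rewrite /= map_polyC map_polyX.
apply: singlet_K_reflection.
- rewrite -tofrac1 -!tofracB tofrac_eq0.
  (* Up to sign, each denominator is monic of degree 1 in the outer variable v, hence nonzero. *)
  have -> : 'X%:P - 'X - 1 = - ('X - ('X - 1)%:P) :> {poly {poly C}}.
    by rewrite polyCB polyC1; ring.
  by rewrite oppr_eq0 polyXsubC_eq0.
- rewrite -tofrac1 -tofracD -tofracB tofrac_eq0.
  have -> : 'X%:P + 'X - 1 = 'X - (1 - 'X)%:P :> {poly {poly C}}.
    by rewrite polyCB polyC1; ring.
  by rewrite polyXsubC_eq0.
Qed.
End Evaluation.

Theorem proposition3p3 (R : realType) (t : R[i]) :
  exists K : 'M[{fraction {poly R[i]}}]_2,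
    [/\ K != 0,
        (forall K' : 'M[{fraction {poly R[i]}}]_2,
           intertwines t K' <-> exists c : {fraction {poly R[i]}}, K' = c *: K)
      & reflection_equation K].
Proof.
exists (singlet_K t%:P%:F 'X%:F); split.
- apply/eqP=> /matrixP /(_ 0 0); rewrite !mxE; apply/eqP.
  exact: singlet_K00_neq0.
- move=> K; split=> [|[c ->]]; first exact: intertwines_singlet_K_unique.
  move=> b /intertwines_singlet_K hb.
  by rewrite -scalemxAl -scalemxAr hb.
- exact: reflection_equation_singlet_K.
Qed.
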